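(* For a complex Banach space $E$, the following are equivalent: (1) $E$ is reflexive; (2) $\mathbb W(E^*,A)=\mathbb K(E^*,A)$ for every Banach space $A$; (3) $\mathbb W(E^*,A)=\mathbb B(E^*,A)$ for every finite-dimensional Banach space $A$.
   Context: All Banach spaces are complex. $\mathbb B(E^*,A)$ and $\mathbb K(E^*,A)$ are the spaces of bounded, respectively compact, linear operators $E^*\to A$. A linear operator $\Lambda:E^*\to A$ is called weak* continuous on bounded sets (wcbs) if for every bounded net $(\psi_\lambda)$ in $E^*$, $\psi_\lambda\to\psi$ in the weak* topology implies $\Lambda(\psi_\lambda)\to\Lambda(\psi)$ in the norm of $A$. $\mathbb W(E^*,A)$ denotes the space of all wcbs linear operators $E^*\to A$. *)

(* Defs.v *)
From HB Require Import structures.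
From mathcomp Require Import all_boot all_order all_algebra.
From mathcomp Require Import complex.
From mathcomp Require Import all_classical all_reals all_analysis.

Set Implicit Arguments.
Unset Strict Implicit.
Unset Printing Implicit Defensive.

Import Order.TTheory GRing.Theory Num.Theory.
Import numFieldNormedType.Exports.

Local Open Scope classical_set_scope.
Local Open Scope ring_scope.
Local Open Scope complex_scope.

Section BoundedMaps.
Context {R : realType} {U V : normedModType R[i]}.
Implicit Types T : U -> V.

Definition unit_ball : set U := [set x | `|x| <= 1].

Definition bounded_map T := exists M : R[i], forall x, `|T x| <= M * `|x|.

Definition compact_map T := precompact (T @` unit_ball).

(* Norms of normed modules over R[i] take their values in R[i]; they are real,
   so the supremum of their real parts is the usual operator norm. *)
Definition opnorm T : R := sup [set complex.Re `|T x| | x in unit_ball].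

Lemma Re_norm (v : V) : (complex.Re `|v|)%:C = `|v|.
Proof. by rewrite RRe_real// ger0_real. Qed.

Lemma Re_ge0 (v : V) : 0 <= complex.Re `|v|.
Proof. by rewrite -lecR Re_norm normr_ge0. Qed.

Lemma bounded_map_ge0 T : bounded_map T ->
  exists2 M : R, 0 <= M & forall x, `|T x| <= M%:C * `|x|.
Proof.
move=> [M TM]; exists (complex.Re `|M|); first by rewrite -lecR RRe_real ?normr_real ?normr_ge0.
move=> x; rewrite RRe_real ?normr_real//; apply: le_trans (TM x) _.
have [->|x0] := eqVneq x 0; first by rewrite normr0 !mulr0.
rewrite ler_wpM2r// real_ler_norm//.
rewrite -[M](mulfK (_ : `|x| != 0)) ?normr_eq0//.
by rewrite realM ?realV ?normr_real// ger0_real// (le_trans _ (TM x)).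
Qed.

Lemma opnorm_has_sup T : bounded_map T ->
  has_sup [set complex.Re `|T x| | x in unit_ball].
Proof.
move=> /bounded_map_ge0[M M0 TM]; split.
  by exists (complex.Re `|T 0|), 0; rewrite //= /unit_ball/= normr0.
exists M => _ [x x1 <-]; rewrite -lecR Re_norm (le_trans (TM x))//.
by rewrite ler_piMr// lecR.
Qed.

Lemma opnorm_ge0 T : bounded_map T -> 0 <= opnorm T.
Proof.
move=> bT; apply: (@le_trans _ _ (complex.Re `|T 0|)); first exact: Re_ge0.
apply: ub_le_sup; first by case: (opnorm_has_sup bT).
by exists 0; rewrite //= /unit_ball/= normr0.
Qed.

Lemma opnorm_le T (M : R) : (forall x, unit_ball x -> `|T x| <= M%:C) ->
  opnorm T <= M.
Proof.
move=> TM; apply: ge_sup.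
  by exists (complex.Re `|T 0|), 0; rewrite //= /unit_ball/= normr0.
by move=> _ [x x1 <-]; rewrite -lecR Re_norm TM.
Qed.

Lemma le_opnorm1 T x : bounded_map T -> unit_ball x ->
  `|T x| <= (opnorm T)%:C.
Proof.
move=> bT x1; rewrite -Re_norm lecR.
by apply: ub_le_sup; [case: (opnorm_has_sup bT)|exists x].
Qed.

Lemma le_opnorm T x : linear T -> bounded_map T ->
  `|T x| <= (opnorm T)%:C * `|x|.
Proof.
move=> lT bT.
have TZ a y : T (a *: y) = a *: T y.
  have T0 : T 0 = 0.
    have := lT 1 0 0; rewrite !scale1r addr0 => /eqP.
    by rewrite -subr_eq0 opprD addrA subrr sub0r oppr_eq0 => /eqP.
  by have := lT a y 0; rewrite T0 !addr0.
have [->|x0] := eqVneq x 0.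
  by rewrite -(scale0r (0 : U)) TZ !scale0r !normr0 mulr0.
have nx0 : 0 < `|x| by rewrite normr_gt0.
rewrite -ler_pdivrMr// mulrC.
have := @le_opnorm1 T (`|x|^-1 *: x) bT.
rewrite /unit_ball/= TZ !normrZ normfV normr_id; apply.
by rewrite mulVf ?gt_eqF.
Qed.

End BoundedMaps.

Arguments unit_ball {R} U.

Section Dual.
Context {R : realType} (E : normedModType R[i]).

Definition dual_pred : {pred E -> R[i]^o} :=
  [pred f | `[< linear f /\ bounded_map f >] ].

Lemma dual_submod_closed : submod_closed dual_pred.
Proof.
split.
  apply/asboolP; split; first by move=> a x y; rewrite /= scaler0 addr0.
  by exists 0 => x; rewrite normr0 mul0r.
move=> a f g /asboolP[lf bf] /asboolP[lg bg]; apply/asboolP; split.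
  by move=> b x y; rewrite !fctE lf lg !scalerDr !scalerA [a * b]mulrC addrACA.
have [M M0 fM] := bounded_map_ge0 bf; have [N N0 gN] := bounded_map_ge0 bg.
exists (`|a| * M%:C + N%:C) => x; rewrite !fctE.
rewrite (le_trans (ler_normD _ _))// mulrDl lerD// normrZ -mulrA.
by rewrite ler_wpM2l.
Qed.

HB.instance Definition _ :=
  GRing.isSubmodClosed.Build _ _ dual_pred dual_submod_closed.

Record dual := Dual {
  dual_val :> E -> R[i]^o;
  dual_valP : dual_val \in dual_pred }.

HB.instance Definition _ := [isSub for dual_val].
HB.instance Definition _ := [Choice of dual by <:].
HB.instance Definition _ := [SubChoice_isSubLmodule of dual by <:].

Lemma dual_linear (f : dual) : linear f.
Proof. by have /asboolP[] := dual_valP f. Qed.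

HB.instance Definition _ (f : dual) :=
  GRing.isLinear.Build R[i] E R[i]^o *:%R f (dual_linear f).

Lemma dual_bounded (f : dual) : bounded_map f.
Proof. by have /asboolP[] := dual_valP f. Qed.

Definition dual_norm (f : dual) : R[i] := (opnorm f)%:C.

Lemma ler_dual_normD f g : dual_norm (f + g) <= dual_norm f + dual_norm g.
Proof.
rewrite /dual_norm -rmorphD lecR; apply: opnorm_le => x x1.
rewrite (le_trans (ler_normD _ _))// rmorphD lerD//;
  exact: le_opnorm1 (dual_bounded _) x1.
Qed.

Lemma dual_normZ_le a f : dual_norm (a *: f) <= `|a| * dual_norm f.
Proof.
rewrite /dual_norm -(RRe_real (normr_real a)) -rmorphM lecR.
apply: opnorm_le => x x1; rewrite normrZ rmorphM.
rewrite -[X in _ <= X * _]/((complex.Re `|a|)%:C) (RRe_real (normr_real a)).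
by rewrite ler_wpM2l// le_opnorm1//; exact: dual_bounded.
Qed.

Lemma dual_normZ a f : dual_norm (a *: f) = `|a| * dual_norm f.
Proof.
apply/eqP; rewrite eq_le dual_normZ_le/=.
have [->|a0] := eqVneq a 0.
  by rewrite normr0 mul0r lecR opnorm_ge0//; exact: dual_bounded.
rewrite -ler_pdivlMl ?normr_gt0// -normfV.
by have := dual_normZ_le a^-1 (a *: f); rewrite scalerA mulVf// scale1r.
Qed.

Lemma dual_normr0_eq0 f : dual_norm f = 0 -> f = 0.
Proof.
move=> f0; apply/val_inj/funext => x /=; apply/eqP; rewrite -normr_eq0.
have := le_opnorm x (dual_linear f) (dual_bounded f).
rewrite -/(dual_norm f) f0 mul0r => fx0.
by apply/eqP/le_anti; rewrite fx0/=.
Qed.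

HB.instance Definition _ := @Lmodule_isNormed.Build R[i] dual dual_norm
  ler_dual_normD dual_normZ dual_normr0_eq0.

Lemma dual_normE (f : dual) : `|f| = (opnorm f)%:C.
Proof. by []. Qed.

Definition weak_star : topologicalType :=
  initial_topology (dual_val : dual -> {ptws E -> R[i]^o}).

End Dual.

Arguments dual_pred {R} E.

Section Reflexive.
Context {R : realType} (E : normedModType R[i]).

Lemma evaluation_subproof (x : E) :
  (fun f : dual E => f x : R[i]^o) \in dual_pred (dual E).
Proof.
apply/asboolP; split; first by [].
exists `|x| => f; rewrite mulrC dual_normE.
exact: le_opnorm (dual_linear f) (dual_bounded f).
Qed.

Definition canonical_embedding (x : E) : dual (dual E) :=
  Dual (evaluation_subproof x).

Definition reflexive_space := range canonical_embedding = setT.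

End Reflexive.

Section Nets.

Definition directed (I : Type) (le : I -> I -> Prop) :=
  [/\ inhabited I, forall i, le i i,
      forall i j k, le i j -> le j k -> le i k &
      forall i j, exists2 k, le i k & le j k].

Definition tails (I : Type) (le : I -> I -> Prop) : set_system I :=
  [set S | exists i, forall j, le i j -> S j].

Definition net_cvg (I : Type) (le : I -> I -> Prop) (T : topologicalType)
    (u : I -> T) (l : T) :=
  u @ tails le --> l.

End Nets.

Section Operators.
Context {R : realType} (E A : normedModType R[i]).

(* Only linear L are considered below, and no boundedness of L is assumed. *)
Definition wcbs (L : dual E -> A) :=
  forall (I : Type) (le : I -> I -> Prop) (psi : I -> dual E) (psi0 : dual E),
    directed le ->
    (exists M, forall i, `|psi i| <= M) ->
    @net_cvg I le (weak_star E) psi psi0 ->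
    net_cvg le (L \o psi) (L psi0).

Definition bounded_operators : set {linear dual E -> A} :=
  [set L | bounded_map L].

Definition compact_operators : set {linear dual E -> A} :=
  [set L | compact_map L].

Definition wcbs_operators : set {linear dual E -> A} :=
  [set L | wcbs L].

Definition finite_dimensional :=
  exists (n : nat) (b : 'I_n -> A),
    forall a, exists c : 'I_n -> R[i], a = \sum_(i < n) c i *: b i.

End Operators.

Arguments bounded_operators {R} E A.
Arguments compact_operators {R} E A.
Arguments wcbs_operators {R} E A.

(* Main.v *)
(* The unit ball of the dual is weak-star compact (Banach-Alaoglu), so the image
   of the ball under a wcbs operator is compact, for every [E]. Conversely, if
   [E] is reflexive and [L] is compact, then [g \o L] is an evaluation for every
   functional [g] on [A]; along a bounded weak-star convergent net the image
   stays in a compact set, and any cluster point is identified with the expected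
   limit because functionals separate points (Hahn-Banach). In finite dimension
   bounded and compact operators agree. Finally, if every functional [phi] on
   the dual is wcbs, then for each [e > 0] it is bounded by [e] on the unit ball of
   the joint kernel of finitely many evaluations (otherwise a net indexed by
   finite sequences of points contradicts wcbs). Extending this restriction with
   norm at most [e] and subtracting, one gets a functional killed by the joint
   kernel, i.e. an evaluation; so [phi] is a norm limit of evaluations, and [E]
   is complete. *)
Require Import Defs.
From HB Require Import structures.
From mathcomp Require Import all_boot all_order all_algebra.
From mathcomp Require Import complex.
From mathcomp Require Import all_classical all_reals all_analysis.
From mathcomp Require Import ring lra.

Set Implicit Arguments.
Unset Strict Implicit.
Unset Printing Implicit Defensive.

Import Order.TTheory GRing.Theory Num.Theory.
Import numFieldNormedType.Exports.

Local Open Scope classical_set_scope.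
Local Open Scope ring_scope.
Local Open Scope complex_scope.

(** * The Hahn-Banach theorem *)

Section HahnBanach.
Context {R : realType}.

(* Partially defined functionals are represented by their graphs; domination
   by [p] with [p 0 = 0] makes a graph closed under real combinations
   single-valued. *)
Definition dominated_graph (X : lmodType R[i]) (p : X -> R) (G : set (X * R)) :=
  [/\ G (0, 0),
      forall (t : R) u v, G u -> G v -> G (t%:C *: u.1 + v.1, t * u.2 + v.2) &
      forall u, G u -> u.2 <= p u.1].

Lemma maximal_dominated_graph (X : lmodType R[i]) (p : X -> R)
    (G0 : set (X * R)) : dominated_graph p G0 ->
  exists G, [/\ dominated_graph p G, G0 `<=` G &
    forall G', dominated_graph p G' -> G `<=` G' -> G' = G].
Proof.
move=> dG0.
(* The guard [G !=set0] lets [P] hold of the empty set, the union of the empty chain. The maximal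
   set is nonempty because [G0] would otherwise be a larger candidate. *)
pose P (G : set (X * R)) := G !=set0 -> dominated_graph p G /\ G0 `<=` G.
have [F FP Ftot|G [PG maxG]] := @Zorn_bigcup _ P.
  move=> [u0 [G1 FG1 G1u0]].
  have dF G : F G -> G !=set0 -> dominated_graph p G by move=> /FP PG /PG[].
  have [[G10 _ _] G01] : dominated_graph p G1 /\ G0 `<=` G1.
    by apply: (FP _ FG1); exists u0.
  split; last by move=> u /G01 G1u; exists G1.
  split; first by exists G1.
  - move=> t u v [Gu FGu Gut] [Gv FGv Gvt].
    have [uv|vu] := Ftot _ _ FGu FGv.
    + exists Gv => //; have [|_ + _] := dF _ FGv; first by exists v.
      by apply => //; exact: uv.
    + exists Gu => //; have [|_ + _] := dF _ FGu; first by exists u.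
      by apply => //; exact: vu.
  - move=> u [Gu FGu Gut]; have [|_ _] := dF _ FGu; first by exists u.
    exact.
have G_neq0 : G !=set0.
  apply/set0P/eqP => G_0; apply: (maxG G0); last by move=> _; split.
  rewrite G_0 properEneq; split; last exact: sub0set.
  by apply/eqP => E0; have [+ _ _] := dG0; rewrite -E0.
have [dG G0G] := PG G_neq0.
exists G; split=> // G' dG' GG'; apply: contrapT => G'G.
apply: (maxG G').
  by rewrite properEneq; split=> //; apply/eqP => GE; exact: G'G.
by move=> _; split=> //; exact: subset_trans GG'.
Qed.

(** One-dimensional extension: each [u.2 - p (u.1 - x0)] lies below each [p (v.1 + x0) - v.2], so
    the supremum [c] of the former is an admissible value at [x0]. By maximality the extended graph
    is [G] itself. *)
Lemma maximal_dominated_graph_total (X : lmodType R[i]) (p : X -> R)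
    (G : set (X * R)) :
    (forall x y, p (x + y) <= p x + p y) ->
    (forall (t : R) x, 0 < t -> p (t%:C *: x) = t * p x) ->
    dominated_graph p G ->
    (forall G', dominated_graph p G' -> G `<=` G' -> G' = G) ->
  forall x, exists r, G (x, r).
Proof.
move=> pD pZ [G0 GD Gp] maxG x0.
have GZ (t : R) u : G u -> G (t%:C *: u.1, t * u.2).
  by move=> Gu; have := GD t u (0, 0) Gu G0; rewrite !addr0.
pose S := [set u.2 - p (u.1 - x0) | u in G].
have SG u v : G u -> G v -> u.2 - p (u.1 - x0) <= p (v.1 + x0) - v.2.
  move=> Gu Gv; rewrite lerBrDr addrAC lerBlDr.
  have := Gp _ (GD 1 u v Gu Gv) => /=; rewrite mul1r rmorph1 scale1r.
  move=> /le_trans; apply.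
  have -> : u.1 + v.1 = (v.1 + x0) + (u.1 - x0).
    by rewrite addrACA subrr addr0 addrC.
  exact: pD.
have S_sup : has_sup S.
  split; first by exists (0 - p (0 - x0)), (0, 0).
  by exists (p (0 + x0) - 0) => _ [u Gu <-]; exact: (SG u (0, 0)).
pose c := sup S.
have cl u : G u -> u.2 - p (u.1 - x0) <= c.
  by move=> Gu; apply: ub_le_sup; [case: S_sup|exists u].
have cr v : G v -> c <= p (v.1 + x0) - v.2.
  by move=> Gv; apply: ge_sup; [case: S_sup|move=> _ [u Gu <-]; exact: SG].
pose G' := [set (ut.1.1 + ut.2%:C *: x0, ut.1.2 + ut.2 * c) | ut in
  [set ut : (X * R) * R | G ut.1]].
have -> : G = G'; last first.
  by exists (0 + 1 * c), ((0, 0), 1) => //=; rewrite scale1r add0r.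
symmetry; apply: maxG; last first.
  by move=> [x r] Gxr; exists ((x, r), 0) => //=; rewrite scale0r mul0r !addr0.
split.
- by exists ((0, 0), 0) => //=; rewrite scale0r mul0r !addr0.
- move=> t _ _ [[u a] Gu <-] [[v b] Gv <-] /=.
  exists ((t%:C *: u.1 + v.1, t * u.2 + v.2), t * a + b) => /=; first exact: GD.
  congr pair; last by rewrite mulrDr mulrDl mulrA addrACA.
  by rewrite scalerDr rmorphD rmorphM scalerDl scalerA addrACA.
(* Dividing by the absolute value of [t] reduces domination to [cr] for positive [t] and to [cl] for
   negative [t]. *)
- move=> _ [[u t] Gu <-] /=.
  have [t0|t0|->] := ltrgtP t 0; last first.
  + by rewrite scale0r mul0r !addr0 Gp.
  + have t1 := cr _ (GZ t^-1 u Gu).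
    have -> : u.1 + t%:C *: x0 = t%:C *: ((t^-1)%:C *: u.1 + x0).
      by rewrite scalerDr scalerA -rmorphM divff ?gt_eqF// scale1r.
    rewrite pZ// -ler_pdivrMl// mulrDr mulKf ?gt_eqF// addrC -lerBrDr.
    exact: t1.
  + have s0 : 0 < - t by rewrite oppr_gt0.
    have t1 := cl _ (GZ (- t)^-1 u Gu).
    have -> : u.1 + t%:C *: x0 = (- t)%:C *: (((- t)^-1)%:C *: u.1 - x0).
      rewrite scalerBr scalerA -rmorphM divff ?gt_eqF// scale1r.
      by rewrite rmorphN scaleNr opprK.
    rewrite pZ// -ler_pdivrMl// mulrDr.
    have -> : (- t)^-1 * (t * c) = - c by rewrite invrN mulNr mulKf ?lt_eqF.
    by rewrite lerBlDr -lerBlDl.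
Qed.

Lemma Re_normD (X : normedModType R[i]) (x y : X) :
  complex.Re `|x + y| <= complex.Re `|x| + complex.Re `|y|.
Proof. by rewrite -lecR rmorphD/= !Re_norm ler_normD. Qed.

Lemma Re_normZ (X : normedModType R[i]) (a : R[i]) (x : X) :
  complex.Re `|a *: x| = complex.Re `|a| * complex.Re `|x|.
Proof.
apply: complexI; rewrite rmorphM/= Re_norm normrZ Re_norm.
by rewrite (@Re_norm _ R[i]^o a).
Qed.

Lemma Re_normZr (X : normedModType R[i]) (t : R) (x : X) : 0 < t ->
  complex.Re `|t%:C *: x| = t * complex.Re `|x|.
Proof. by move=> t0; rewrite Re_normZ ger0_norm// lecR ltW. Qed.

End HahnBanach.

(** * Norm-preserving extension of complex functionals *)

Section ComplexHahnBanach.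
Context {R : realType} (X : normedModType R[i]).

(** The real part of [H] extends to a real-linear [U] dominated by [M] times the norm, and a complex
    functional is recovered from its real part as [U x - i U (i x)]. *)
Theorem hahn_banach (M : R) (H : set (X * R[i])) : 0 <= M -> H (0, 0) ->
    (forall a u v, H u -> H v -> H (a *: u.1 + v.1, a * u.2 + v.2)) ->
    (forall u, H u -> `|u.2| <= M%:C * `|u.1|) ->
  exists f : dual X, (forall x, `|f x| <= M%:C * `|x|) /\
    forall u, H u -> f u.1 = u.2.
Proof.
move=> M0 H0 HD HM.
pose p (x : X) := M * complex.Re `|x|.
have pD x y : p (x + y) <= p x + p y by rewrite -mulrDr ler_wpM2l// Re_normD.
have pZ (t : R) x : 0 < t -> p (t%:C *: x) = t * p x.
  by move=> t0; rewrite /p Re_normZr// mulrCA.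
pose G0 := [set (u.1, complex.Re u.2) | u in H].
have dG0 : dominated_graph p G0.
  split; first by exists (0, 0).
  - move=> t _ _ [u Hu <-] [v Hv <-].
    exists (t%:C *: u.1 + v.1, t%:C * u.2 + v.2).
      exact: HD.
    congr pair; case: (u.2) => a b; case: (v.2) => c d /=.
    by rewrite mul0r subr0.
  - move=> _ [u Hu <-] /=; rewrite /p.
    have := HM u Hu; rewrite -(Re_norm u.1) -rmorphM => Hle.
    rewrite -lecR (le_trans _ Hle)// (le_trans _ (normc_ge_Re _))// lecR.
    exact: ler_norm.
have [G [[GG0 GD Gp] G0G maxG]] := maximal_dominated_graph dG0.
have Gtot := maximal_dominated_graph_total pD pZ (And3 GG0 GD Gp) maxG.
pose U x := projT1 (cid (Gtot x)).
have GU x : G (x, U x) by rewrite /U; case: cid.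
(* The difference of two values over [x] is a value over [0], where [p] vanishes. *)
have Gle x r s : G (x, r) -> G (x, s) -> r <= s.
  move=> Gr Gs; have := Gp _ (GD (-1) _ _ Gs Gr) => /=.
  rewrite rmorphN rmorph1 scaleN1r addNr /p normr0 mulr0 mulN1r addrC.
  by rewrite subr_le0.
have Guniq x r s : G (x, r) -> G (x, s) -> r = s.
  by move=> Gr Gs; apply/le_anti; rewrite !(Gle x).
have UD (t : R) x y : U (t%:C *: x + y) = t * U x + U y.
  by apply: (Guniq (t%:C *: x + y)) => //; exact: GD (GU x) (GU y).
have U0 : U 0 = 0 by exact: (Guniq 0).
have UDD x y : U (x + y) = U x + U y.
  by have := UD 1 x y; rewrite rmorph1 scale1r mul1r.
have UZ (t : R) x : U (t%:C *: x) = t * U x.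
  by have := UD t x 0; rewrite U0 !addr0.
have UN x : U (- x) = - U x.
  by have := UZ (-1) x; rewrite rmorphN rmorph1 scaleN1r mulN1r.
pose f (x : X) : R[i]^o := U x +i* - U ('i *: x).
have fZ a x : f (a *: x) = a *: f x.
  case: a => a b.
  have -> : (a +i* b) *: x = a%:C *: x + b%:C *: ('i *: x).
    by rewrite scalerA -scalerDl; congr (_ *: _); rewrite [LHS]complexE mulrC.
  have ii : 'i *: ('i *: x) = - x.
    by rewrite scalerA -expr2 sqr_i scaleN1r.
  rewrite /f scalerDr !(scalerA 'i) ![_ * _%:C]mulrC -!scalerA ii !(UDD, UZ) UN.
  rewrite -[RHS]/((a +i* b) * (U x -i* U ('i *: x))).
  by congr Complex; rewrite !mulrN ?opprK// opprD opprK.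
have fD x y : f (x + y) = f x + f y.
  by rewrite /f scalerDr !UDD opprD.
have fl : linear f by move=> a x y; rewrite fD fZ.
have fM x : `|f x| <= M%:C * `|x|.
  have [fx0|fx0] := eqVneq (f x) 0.
    by rewrite fx0 normr0 mulr_ge0// lecR.
  (* Rotating [x] by the unimodular [c] makes [f (c *: x)] real and nonnegative, so that it equals
     [U (c *: x)], which [p] bounds. *)
  pose c := `|f x| / f x.
  have c1 : `|c| = 1 by rewrite normrM normfV normr_id divff ?normr_eq0.
  have fcx : f (c *: x) = `|f x|.
    by rewrite fZ /c /GRing.scale /= mulfVK.
  have <- : `|c *: x| = `|x| by rewrite normrZ c1 mul1r.
  rewrite -(@Re_norm _ R[i]^o) -(Re_norm (c *: x)) -rmorphM lecR -fcx.
  exact: Gp (GU _).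
have fdual : f \in dual_pred X by apply/asboolP; split=> //; exists M%:C.
exists (Dual fdual); split=> // u Hu /=.
have HU v : H v -> U v.1 = complex.Re v.2.
  by move=> Hv; apply: (Guniq v.1) => //; apply: G0G; exists v.
(* The imaginary part is read off at ['i *: u.1], since the real part of [i z] is minus the
   imaginary part of [z]. *)
have := HU _ (HD 'i _ _ Hu H0); rewrite /= !addr0 /f HU// => ->.
by case: (u.2) => a b /=; rewrite mul0r mul1r sub0r opprK.
Qed.

(** Extends the functional sending [a *: x] to [a] times the norm of [x] from the line through
    [x]. *)
Lemma norming_functional (x : X) :
  exists f : dual X, (forall y, `|f y| <= `|y|) /\ f x = `|x|.
Proof.
have [|||f [f1 fx]] :=
  @hahn_banach 1 [set (a *: x, a * `|x|) | a in setT] ler01.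
- by exists 0 => //; rewrite scale0r mul0r.
- move=> a _ _ [b _ <-] [c _ <-]; exists (a * b + c) => //=.
  by rewrite scalerDl scalerA mulrDl mulrA.
- by move=> _ [a _ <-] /=; rewrite mul1r normrM normrZ normr_id.
exists f; split; first by move=> y; have := f1 y; rewrite mul1r.
by have := fx (x, `|x|); apply; exists 1 => //; rewrite scale1r mul1r.
Qed.

Lemma dual_separates (x : X) : (forall f : dual X, f x = 0) -> x = 0.
Proof.
move=> fx0; have [f [_ fx]] := norming_functional x.
by apply/normr0_eq0; rewrite -fx fx0.
Qed.

End ComplexHahnBanach.

(** * Compactness and completeness of the complex line *)

Section ComplexTopology.
Context {R : realType}.
Implicit Types X A : normedModType R[i].

Lemma normr_real_complex (t : R) : `|t%:C| = `|t|%:C :> R[i].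
Proof.
rewrite normc_def /= (_ : 0 ^+ 2 = 0); first by rewrite addr0 sqrtr_sqr.
by rewrite expr0n.
Qed.

Lemma normr_i : `|'i| = 1 :> R[i].
Proof.
rewrite normc_def /= (_ : 0 ^+ 2 = 0); last by rewrite expr0n.
by rewrite expr1n add0r sqrtr1.
Qed.

Lemma normc_ge_Im (z : R[i]) : `|complex.Im z|%:C <= `|z|.
Proof.
have := normc_ge_Re (z * 'i); rewrite ReiNIm normrN; congr (_ <= _).
by rewrite normrM normr_i mulr1.
Qed.

Lemma Re_norm_dist X (x y : X) :
  `|complex.Re `|x| - complex.Re `|y| | <= complex.Re `|x - y|.
Proof.
by rewrite -lecR -normr_real_complex rmorphB/= !Re_norm ler_dist_dist.
Qed.

Lemma Re_norm_continuous X : continuous (fun x : X => complex.Re `|x|).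
Proof.
move=> x; apply/cvgrPdist_lt => e e0.
have : nbhs x (ball x e%:C) by apply: nbhsx_ballx; rewrite ltcR.
apply: filterS => y; rewrite -ball_normE /= -(Re_norm (x - y)) ltcR.
exact/le_lt_trans/Re_norm_dist.
Qed.

Lemma closed_norm_le X (M : R) : closed [set x : X | `|x| <= M%:C].
Proof.
rewrite (_ : mkset _ = (fun x : X => complex.Re `|x|) @^-1` [set r | r <= M]).
  by apply: preimage_closed => [x _|]; [exact: Re_norm_continuous|exact: closed_le].
by apply/seteqP; split=> x /=; rewrite -lecR Re_norm.
Qed.

Lemma compact_norm_bounded X (K : set X) : compact K ->
  exists M : R, forall x, K x -> `|x| <= M%:C.
Proof.
move=> cK; have : compact [set complex.Re `|x| | x in K].
  apply: continuous_compact => //; apply: continuous_subspaceT.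
  exact: Re_norm_continuous.
move=> /compact_bounded[M [_ KM]]; exists (M + 1) => x Kx.
rewrite -Re_norm lecR (le_trans (ler_norm _))// KM//; first by rewrite ltrDl.
by exists x.
Qed.

Lemma complex_of_reals_continuous :
  continuous (fun ab : R * R => (ab.1 +i* ab.2 : R[i]^o)).
Proof.
move=> [a b]; apply/cvgrPdist_lt => e e0.
have eE : e = (complex.Re e)%:C by rewrite RRe_real// gtr0_real.
have e'0 : 0 < complex.Re e / 2 by rewrite divr_gt0// -ltcR -eE.
near=> z.
have z1 : `|a - z.1| < complex.Re e / 2.
  near: z; apply: (@cvgr_dist_lt _ R^o _ (nbhs (a, b)) _ fst a) => //.
  exact: cvg_fst.
have z2 : `|b - z.2| < complex.Re e / 2.
  near: z; apply: (@cvgr_dist_lt _ R^o _ (nbhs (a, b)) _ snd b) => //.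
  exact: cvg_snd.
have -> : (a +i* b : R[i]^o) - (z.1 +i* z.2) = (a - z.1)%:C + 'i * (b - z.2)%:C.
  exact: complexE (Complex _ _).
rewrite (le_lt_trans (ler_normD _ _))//.
rewrite normrM normr_i mul1r !normr_real_complex -rmorphD eE ltcR [ltRHS]splitr.
by rewrite ltrD.
Unshelve. all: by end_near. Qed.

Lemma disc_compact (M : R) : compact [set z : R[i]^o | `|z| <= M%:C].
Proof.
have : compact [set (ab.1 +i* ab.2 : R[i]^o) |
    ab in `[- M, M]%classic `*` `[- M, M]%classic].
  apply: continuous_compact.
    by apply: continuous_subspaceT; exact: complex_of_reals_continuous.
  by apply: compact_setX; exact: segment_compact.
move=> cS; apply: (subclosed_compact _ cS); first exact: closed_norm_le.
move=> z /= zM; exists (complex.Re z, complex.Im z); last by case: z {zM}.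
by split; rewrite /= in_itv /= -ler_norml -lecR (le_trans _ zM)//;
  [exact: normc_ge_Re|exact: normc_ge_Im].
Qed.

(** A Cauchy filter contains a unit ball, hence a compact disc, where it must converge. *)
Lemma complex_complete (F : set_system R[i]^o) :
  ProperFilter F -> cauchy F -> cvg F.
Proof.
move=> FF Fc; have /cauchyP /(_ 1 ltr01)[z Fz] := Fc.
apply: (compact_cauchy_cvg FF Fc _ (@disc_compact (complex.Re `|z| + 1))).
apply: filterS Fz => w; rewrite -ball_normE /= => zw.
rewrite rmorphD/= (@Re_norm _ R[i]^o) -{1}(subrK z w).
by rewrite (le_trans (ler_normD _ _))// addrC lerD2l distrC rmorph1 ltW.
Qed.

End ComplexTopology.

(* The canonical [completeType] structure on [GRing.regular] is already taken by
   [realType], hence this explicit packing. *)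
Definition complex_line (R : realType) : completeNormedModType R[i] :=
  HB.pack R[i]^o (Uniform_isComplete.Build R[i]^o (@complex_complete R)).

(** * The Banach-Alaoglu theorem *)

Section WeakStar.
Context {R : realType} (E : normedModType R[i]).

Lemma weak_star_cvgP (F : set_system (dual E)) (g : dual E) : Filter F ->
  F --> (g : weak_star E) <-> forall x, f x @[f --> F] --> g x.
Proof.
move=> FF; have <- : {ptws, (@dual_val R E @ F) --> (g : E -> R[i]^o)} <->
    forall x, f x @[f --> F] --> g x.
  by split=> [/pointwise_cvgP //|h]; apply/pointwise_cvgP.
split=> Fg.
  apply: cvg_trans; last first.
    exact: (@initial_continuous _ _ (@dual_val R E : _ -> {ptws E -> R[i]^o}) g).
  by apply: cvg_app; exact: Fg.
move=> A [_ [[B oB <-] Bg BA]].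
by apply: filterS BA _; apply: Fg; exact: open_nbhs_nbhs.
Qed.

Lemma dual_unit_ballP (f : dual E) :
  unit_ball (dual E) f <-> forall x, `|f x| <= `|x|.
Proof.
split=> [f1 x|f1].
  rewrite (le_trans (le_opnorm x (dual_linear f) (dual_bounded f)))//.
  by rewrite ler_piMl// -dual_normE.
rewrite /unit_ball/= dual_normE lecR; apply: opnorm_le => x x1.
by rewrite rmorph1 (le_trans (f1 x)).
Qed.

Lemma ler_dual_apply (f : dual E) x : `|f x| <= `|f| * `|x|.
Proof. exact: le_opnorm (dual_linear f) (dual_bounded f). Qed.

(** Pointwise, the dual ball sits in a product of discs, compact by Tychonoff. A cluster point there
    is again linear, because linear identities pass to pointwise limits. *)
Theorem banach_alaoglu : compact (unit_ball (dual E) : set (weak_star E)).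
Proof.
move=> F FF Fball.
pose K := [set f : {ptws E -> R[i]^o} |
  forall x, [set z : R[i]^o | `|z| <= `|x|] (f x)].
have cK : compact K.
  apply: (@tychonoff E (fun=> R[i]^o) (fun x => [set z | `|z| <= `|x|])) => x.
  by rewrite -Re_norm; exact: disc_compact.
pose F' := @dual_val R E @ F : set_system {ptws E -> R[i]^o}.
have FK : F (@dual_val R E @^-1` K).
  by apply: filterS Fball => f /dual_unit_ballP f1 x; exact: f1.
have [p [Kp]] := cK F' _ FK.
move=> /[dup] clp; rewrite cluster_cvgE => -[G PG [Gp F'G]].
have {}Gp : forall x, f x @[f --> G] --> p x.
  exact: (pointwise_cvgP p _).1 Gp.
have pl : linear p.
  move=> a x y; apply/eqP; rewrite -subr_eq0; apply/eqP.
  have : (f (a *: x + y) - (a *: f x + f y) : R[i]^o) @[f --> G]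
      --> p (a *: x + y) - (a *: p x + p y).
    by apply: cvgB => //; apply: cvgD => //; exact: cvgZr.
  move=> /(cvg_unique (@norm_hausdorff _ _)); apply.
  apply: cvg_near_cst; apply: F'G.
  suff lF (f : dual E) : f (a *: x + y) - (a *: f x + f y) = 0.
    exact: nearW lF.
  by rewrite linearP subrr.
have pd : p \in dual_pred E.
  by apply/asboolP; split=> //; exists 1 => x; rewrite mul1r; exact: Kp.
exists (Dual pd); split; first exact/dual_unit_ballP.
(* Weak-star neighbourhoods contain preimages of pointwise open sets, so clustering at [p] in the
   product descends to the dual. *)
move=> A B FA [_ [[C oC <-] Cp CB]].
have FA' : F (@dual_val R E @^-1` (@dual_val R E @` A)).
  by apply: filterS FA => f Af; exists f.
have [_ [[f Af <-] Cf]] := clp _ _ FA' (open_nbhs_nbhs (conj oC Cp)).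
by exists f; split=> //; exact: CB.
Qed.

End WeakStar.

(** * From nets to filters, and compactness of wcbs operators *)

Section Wcbs.
Context {R : realType} (E A : normedModType R[i]).

(** Turns the filter into a net: indices are pairs of a bounded member of [F] and a point of it,
    ordered by reverse inclusion of the members. *)
Lemma wcbs_filter (L : dual E -> A) (M : R[i]) (F : set_system (dual E))
    (g : dual E) :
  wcbs L -> ProperFilter F -> F [set f | `|f| <= M] ->
  F --> (g : weak_star E) -> L @ F --> L g.
Proof.
move=> wL FF FM Fg.
pose BM : set (dual E) := [set f | `|f| <= M].
pose I := {p : set (dual E) * dual E | [/\ F p.1, p.1 `<=` BM & p.1 p.2]}.
pose le (i j : I) := (sval j).1 `<=` (sval i).1.
pose psi (i : I) := (sval i).2.
have mkI (S : set (dual E)) : F S -> exists i : I, (sval i).1 `<=` S.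
  move=> FS; have FSM : F (S `&` BM) by exact: filterI.
  have [f Sf] := filter_ex FSM.
  have p : [/\ F (S `&` BM), S `&` BM `<=` BM & (S `&` BM) f].
    by split=> //; exact: subIsetr.
  by exists (exist _ (_, f) p) => /= ? [].
have dI : directed le.
  split=> [|i|i j k ij jk|i j].
  - by have [i _] := mkI _ FM; exists.
  - exact: subset_refl.
  - exact: subset_trans jk ij.
  - have Fi : F (sval i).1 by case: (svalP i).
    have Fj : F (sval j).1 by case: (svalP j).
    have [|k kij] := mkI ((sval i).1 `&` (sval j).1); first exact: filterI.
    by exists k; [move=> f /kij[]|move=> f /kij[]].
have psiF : psi @ tails le --> F.
  move=> S /mkI[i iS]; exists i => j ij; apply: iS; apply: ij.
  by case: (svalP j).
(* Every point [f] of the set at index [i] is the value of the net at the later index with the same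
   set and point [f], so a tail covers that whole set. *)
have tF (S : set A) : (L \o psi @ tails le) S -> F (L @^-1` S).
  move=> [i iS]; have [Fi ib _] := svalP i.
  apply: filterS Fi => f if_.
  have p : [/\ F (sval i).1, (sval i).1 `<=` BM & (sval i).1 f].
    by split => //; case: (svalP i).
  exact: (iS (exist _ ((sval i).1, f) p)).
have psiM : exists M, forall i : I, `|psi i| <= M.
  by exists M => i; have [_ iM ip] := svalP i; exact: iM.
have := wL I le psi g dI psiM (cvg_trans psiF Fg).
by move=> Lg S /Lg /tF.
Qed.

(** A filter on the image is pulled back to the ball, where Banach-Alaoglu gives a finer filter
    converging weak-star to some [g]; its image under [L] converges to [L g]. *)
Lemma wcbs_compact (L : dual E -> A) :
  wcbs L -> compact (L @` unit_ball (dual E)).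
Proof.
move=> wL F FF FL.
pose G := filter_from F (fun S => unit_ball (dual E) `&` L @^-1` S).
have PG : ProperFilter G.
  apply: filter_from_proper; last first.
    move=> S FS; have FLS : F (L @` unit_ball (dual E) `&` S) by exact: filterI.
    by have [_ [[f f1 <-] Sf]] := filter_ex FLS; exists f.
  apply: filter_from_filter; first by exists setT; exact: filterT.
  move=> S T FS FT; exists (S `&` T); first exact: filterI.
  by move=> f [f1 [Sf Tf]].
have G1 : G (unit_ball (dual E)).
  by exists setT; [exact: filterT|move=> f []].
have [g [g1]] := banach_alaoglu PG G1.
rewrite cluster_cvgE => -[H PH [Hg GH]].
exists (L g); split; first by exists g.
rewrite cluster_cvgE; exists (L @ H); first exact: fmap_proper_filter.
split.
  by apply: (wcbs_filter wL _ _ Hg); exact: (GH _ G1).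
by move=> S FS; apply: GH; exists S => // f [].
Qed.

Lemma wcbs_compact_map (L : dual E -> A) : wcbs L -> compact_map L.
Proof.
move=> wL; rewrite /compact_map precompact_closed; first exact: wcbs_compact.
exact: compact_closed (@norm_hausdorff _ _) (wcbs_compact wL).
Qed.

End Wcbs.

(** * Compact operators on the dual of a reflexive space *)

Section Compactness.
Context {R : realType}.

(** If some neighbourhood of [l] were not in [F], the trace of [F] on its complement would cluster
    in [K], necessarily at [l], which is absurd. *)
Lemma compact_cluster_cvg (T : topologicalType) (K : set T) (F : set_system T)
    (l : T) : compact K -> ProperFilter F -> F K ->
  (forall y, cluster F y -> y = l) -> F --> l.
Proof.
move=> cK FF FK clF S Sl; apply: contrapT => FS.
have PW : ProperFilter (within (~` S) F).
  split; last exact: within_filter.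
  rewrite /within /= => F0; apply: FS; move: F0; apply: filterS => x /= Sx.
  exact: contrapT.
have WF P : F P -> within (~` S) F P by rewrite /within /=; apply: filterS.
have [y [_ cly]] := cK _ PW (WF _ FK).
have yl : y = l.
  by apply: clF => P Q FP Qy; apply: cly => //; exact: WF.
have WS : within (~` S) F (~` S) by exact: withinT.
by rewrite yl in cly; have [z []] := cly _ _ WS Sl.
Qed.

Lemma tails_proper (I : Type) (le : I -> I -> Prop) :
  directed le -> ProperFilter (tails le).
Proof.
move=> [[i0] lexx letr ledir]; split.
  by move=> [i /(_ i)]; apply.
split.
- by exists i0.
- move=> P Q [i iP] [j jQ]; have [k ik jk] := ledir i j.
  by exists k => l kl; split; [apply/iP/(letr i k)|apply/jQ/(letr j k)].
- by move=> P Q PQ [i iP]; exists i => j ij; apply/PQ/iP.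
Qed.

Lemma bounded_on_ball (X A : normedModType R[i]) (L : {linear X -> A}) (M : R) :
  0 <= M -> (forall x, unit_ball X x -> `|L x| <= M%:C) ->
  forall x, `|L x| <= M%:C * `|x|.
Proof.
move=> M0 LM x; have [->|x0] := eqVneq x 0.
  by rewrite linear0 !normr0 mulr0.
have nx : 0 < `|x| by rewrite normr_gt0.
rewrite -ler_pdivrMr// mulrC.
have := LM (`|x|^-1 *: x); rewrite /unit_ball/= linearZ !normrZ normfV normr_id.
by apply; rewrite mulVf// gt_eqF.
Qed.

Lemma compact_map_bounded (X A : normedModType R[i]) (L : {linear X -> A}) :
  compact_map L -> bounded_map L.
Proof.
move=> [K LK [cK _]]; have [M KM] := compact_norm_bounded cK.
have LM x : unit_ball X x -> `|L x| <= M%:C by move=> x1; apply/KM/LK; exists x.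
have M0 : 0 <= M by rewrite -lecR (le_trans _ (LM 0 _))// /unit_ball/= normr0.
by exists M%:C; exact: bounded_on_ball LM.
Qed.

Lemma dual_continuous (X : normedModType R[i]) (g : dual X) : continuous g.
Proof.
move=> x; apply/cvgrPdist_lt => e e0.
have g0 : 0 < `|g| + 1 by rewrite ltr_wpDl.
have : nbhs x (ball x (e / (`|g| + 1))) by apply: nbhsx_ballx; rewrite divr_gt0.
apply: filterS => y; rewrite -ball_normE /= ltr_pdivlMr// => xy.
rewrite -linearB (le_lt_trans (ler_dual_apply _ _))// (le_lt_trans _ xy)//.
by rewrite mulrC ler_wpM2l// lerDl.
Qed.

Lemma compact_map_wcbs (E A : normedModType R[i]) (L : {linear dual E -> A}) :
  reflexive_space E -> compact_map L -> wcbs L.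
Proof.
move=> rE cL I le psi psi0 dI [M psiM] psi_cvg.
have PT := tails_proper dI.
have [K LK [cK _]] := cL.
(* The [+ 1] makes [r] invertible; rescaling by [r] moves the net into the unit ball, so its image
   lies in the compact set [K']. *)
pose r := complex.Re M + 1.
have [i0] : inhabited I by case: dI.
have M0 : 0 <= M by rewrite (le_trans _ (psiM i0)).
have ME : M = (complex.Re M)%:C by rewrite RRe_real// ger0_real.
have r0 : 0 < r by rewrite ltr_wpDl// -lecR -ME.
have rC0 : 0 < r%:C by rewrite ltcR.
pose K' := [set r%:C *: a | a in K].
have cK' : compact K'.
  apply: continuous_compact => //; apply: continuous_subspaceT => a.
  exact: scaler_continuous.
have psiK i : K' (L (psi i)).
  exists (L (r%:C^-1 *: psi i)); last first.
    by rewrite linearZ scalerA divff ?gt_eqF// scale1r.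
  apply: LK; exists (r%:C^-1 *: psi i) => //; rewrite /unit_ball/= normrZ normfV.
  rewrite gtr0_norm// ler_pdivrMl// mulr1 (le_trans (psiM i))//.
  by rewrite ME lecR lerDl.
apply: (compact_cluster_cvg cK').
  by exists i0 => j _; exact: psiK.
move=> y; rewrite cluster_cvgE => -[G PG [Gy LG]].
apply/eqP; rewrite -subr_eq0; apply/eqP; apply: dual_separates => g.
have gLd : (fun f : dual E => g (L f) : R[i]^o) \in dual_pred (dual E).
  apply/asboolP; split; first by move=> a u v; rewrite !linearP.
  have [N N0 LN] := bounded_map_ge0 (compact_map_bounded cL).
  exists (`|g| * N%:C) => f; rewrite (le_trans (ler_dual_apply _ _))// -mulrA.
  by rewrite ler_wpM2l.
have [x _ xE] : range (@canonical_embedding R E) (Dual gLd) by rewrite rE.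
have gLx f : g (L f) = f x by have := congr1 (fun h : dual (dual E) => h f) xE.
(* Along [G], [g] tends to [g y] by continuity and to [g (L psi0)] by weak-star convergence tested
   at [x]. *)
have g1 : g a @[a --> G] --> g y by move=> S /(@dual_continuous _ g y) /Gy.
have g2 : g a @[a --> G] --> g (L psi0).
  apply: cvg_trans; first by apply: cvg_app; exact: LG.
  rewrite gLx => S /((weak_star_cvgP psi0 _).1 psi_cvg x)[i iS].
  by exists i => j /iS; rewrite /= gLx.
rewrite linearB; apply/eqP; rewrite subr_eq0; apply/eqP.
exact: (cvg_unique (@norm_hausdorff _ _) g1 g2).
Qed.

End Compactness.

(** * Finite-dimensional targets *)

Section FiniteDimension.
Context {R : realType} (A : normedModType R[i]).

Definition spanned n (b : 'I_n -> A) :=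
  [set \sum_(i < n) c i *: b i | c in [set: 'I_n -> R[i]]].

Lemma spanned_recl n (b : 'I_n.+1 -> A) :
  spanned b =
    [set v + c *: b ord0 | v in spanned (b \o lift ord0) & c in [set: R[i]]].
Proof.
apply/seteqP; split=> [_ [c _ <-]|_ [_ [c _ <-] [d _ <-]]].
  exists (\sum_(i < n) c (lift ord0 i) *: b (lift ord0 i)).
    by exists (c \o lift ord0).
  by exists (c ord0) => //; rewrite big_ord_recl addrC.
exists (fun i => if unlift ord0 i is Some j then c j else d) => //.
rewrite big_ord_recl unlift_none addrC; congr (_ + _).
by apply: eq_bigr => i _; rewrite liftK.
Qed.

Lemma spanned_linear n (b : 'I_n -> A) a u v :
  spanned b u -> spanned b v -> spanned b (a *: u + v).
Proof.
move=> [c _ <-] [d _ <-]; exists (fun i => a * c i + d i) => //.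
rewrite scaler_sumr -big_split; apply: eq_bigr => i _.
by rewrite scalerDl scalerA.
Qed.

(** Induction on [n]: when [b0] is independent of the span [V] of the others, the ball is a closed
    part of the continuous image of a ball of [V] times a disc of coefficients. *)
Lemma spanned_ball_compact n (b : 'I_n -> A) (M : R) :
  compact (spanned b `&` [set a | `|a| <= M%:C]).
Proof.
elim: n b M => [|n IH] b M.
  apply: (subclosed_compact _ (@compact_set1 _ (0 : A))).
    apply: closedI; last exact: closed_norm_le.
    rewrite (_ : spanned b = [set 0]).
      exact: (accessible_closed_set1 (hausdorff_accessible (@norm_hausdorff _ _))).
    apply/seteqP; split=> [_ [c _ <-]|_ ->]; first by rewrite big_ord0.
    by exists (fun=> 0) => //; rewrite big_ord0.
  by move=> _ [[c _ <-] _]; rewrite big_ord0.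
set V := spanned (b \o lift ord0).
have Vlin a u v : V u -> V v -> V (a *: u + v) by exact: spanned_linear.
have V0 : V 0.
  by exists (fun=> 0) => //; rewrite big1 // => i _; rewrite scale0r.
have VZ a u : V u -> V (a *: u).
  by move=> Vu; have := Vlin a u 0 Vu V0; rewrite addr0.
rewrite spanned_recl -/V; set b0 := b ord0.
have [Vb|Vb] := pselect (V b0).
  rewrite (_ : [set _ | _ in V & _ in _] = V); first exact: IH.
  apply/seteqP; split=> [_ [v Vv [c _ <-]]|v Vv].
    by rewrite addrC; exact: Vlin.
  by exists v => //; exists 0 => //; rewrite scale0r addr0.
(* Since [b0] lies outside the closed subspace [V], it is at a distance [d > 0]
   from it, which bounds the coefficient [c] of [v + c *: b0] by its norm. *)
have Vcl : closed V.
  move=> a clVa; have := IH (b \o lift ord0) (complex.Re `|a| + 1).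
  move=> /(compact_closed (@norm_hausdorff _ _)) cl.
  (* Points of [V] within distance 1 of [a] lie in a ball of [V] that is compact by induction, hence
     closed. *)
  suff : (V `&` [set u | `|u| <= (complex.Re `|a| + 1)%:C]) a by case.
  apply: cl => S Sa.
  have /clVa [u [Vu [Su au]]] : nbhs a (S `&` ball a 1).
    by apply: filterI => //; exact: nbhsx_ballx.
  exists u; split=> //; split=> //=.
  move: au; rewrite -ball_normE /= => au.
  rewrite rmorphD/= Re_norm -{1}(subrK a u).
  by rewrite (le_trans (ler_normD _ _))// addrC lerD2l distrC rmorph1 ltW.
have [d d0 Vd] : exists2 d : R, 0 < d & forall v, V v -> d%:C <= `|b0 - v|.
  have : nbhs b0 (~` V).
    by apply: open_nbhs_nbhs; split=> //; exact: closed_openC.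
  move=> /nbhs_ballP[e /= e0 eV].
  have er : e \is Num.real by exact: gtr0_real.
  exists (complex.Re e) => [|v Vv]; first by rewrite -ltcR RRe_real.
  rewrite RRe_real// real_leNgt ?normr_real//; apply/negP => bv.
  by apply: (eV v) => //; rewrite -ball_normE.
have cM c v : V v -> `|v + c *: b0| <= M%:C -> `|c| <= (M / d)%:C.
  move=> Vv vcM; have [->|c0] := eqVneq c 0.
    rewrite normr0 lecR divr_ge0 ?(ltW d0)// -lecR (le_trans _ vcM)//.
  have := Vd _ (VZ (- c^-1) _ Vv).
  rewrite rmorphM /= fmorphV ler_pdivlMr ?ltcR// => h.
  have : `|c| * d%:C <= `|c| * `|b0 - - c^-1 *: v| by rewrite ler_wpM2l.
  move=> /le_trans; apply; rewrite -normrZ.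
  by rewrite scaleNr opprK scalerDr scalerA divff// scale1r addrC.
(* Bounds the norm of [v], written as [(v + c *: b0) - c *: b0]. *)
pose N := M + M / d * complex.Re `|b0|.
have : compact [set vc.1 + vc.2 *: b0 | vc in
    (V `&` [set v | `|v| <= N%:C]) `*` [set c : R[i]^o | `|c| <= (M / d)%:C]].
  apply: continuous_compact; last first.
    by apply: compact_setX; [exact: IH|exact: disc_compact].
  apply: continuous_subspaceT => -[v c].
  apply: (@cvgD _ A _ (nbhs (v, c)) _ (fun vc : A * R[i]^o => vc.1)
    (fun vc : A * R[i]^o => vc.2 *: b0)); first exact: cvg_fst.
  apply: (@cvgZl _ A _ (nbhs (v, c)) _ (fun vc : A * R[i]^o => vc.2)).
  exact: cvg_snd.
have -> : [set v + c *: b0 | v in V & c in [set: R[i]]]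
    `&` [set a | `|a| <= M%:C] =
  [set vc.1 + vc.2 *: b0 | vc in
    (V `&` [set v | `|v| <= N%:C]) `*` [set c : R[i]^o | `|c| <= (M / d)%:C]]
   `&` [set a | `|a| <= M%:C].
  apply/seteqP; split=> [_ [[v Vv [c _ <-]] /= vcM]
                        |_ [[[v c] [[/= Vv vN] cMd] <-] vcM]].
    split=> //; exists (v, c) => //; split=> /=; last exact: cM vcM.
    split=> //=; rewrite -[v](addrK (c *: b0)) /N rmorphD.
    rewrite (le_trans (ler_normB _ _))// lerD// normrZ rmorphM/= Re_norm.
    by rewrite ler_wpM2r//; exact: cM vcM.
  by split=> //; exists v => //; exists c.
by move=> cS; apply: compact_closedI => //; exact: closed_norm_le.
Qed.

Lemma bounded_map_compact (X : normedModType R[i]) (L : {linear X -> A}) :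
  finite_dimensional A -> bounded_map L -> compact_map L.
Proof.
move=> [n [b bA]] /bounded_map_ge0[M M0 LM].
have cK := @spanned_ball_compact n b M.
exists (spanned b `&` [set a | `|a| <= M%:C]).
  move=> _ [x x1 <-]; split.
    by have [c ->] := bA (L x); exists c.
  by rewrite /= (le_trans (LM x))// ler_piMr// lecR.
by split=> //; exact: compact_closed (@norm_hausdorff _ _) cK.
Qed.

End FiniteDimension.

(** * Functionals that are weak-star continuous on bounded sets *)

Section Grothendieck.
Context {R : realType} (E : completeNormedModType R[i]).

(** Induction on [s]: either [x] is redundant given the other points, or some [f0] killed by them
    has [f0 x] nonzero, and subtracting [c] times evaluation at [x] reduces to the shorter
    sequence. *)
Lemma evaluation_of_joint_kernel (s : seq E) (l : {linear dual E -> R[i]^o}) :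
    (forall f : dual E, (forall x, x \in s -> f x = 0) -> l f = 0) ->
  exists x, forall f, l f = f x.
Proof.
elim: s l => [|x s IH] l ls.
  by exists 0 => f; rewrite linear0 ls.
have [[f0 [f0s f0x]]|nf0] := pselect (exists f0 : dual E,
    (forall y, y \in s -> f0 y = 0) /\ f0 x != 0); last first.
  apply: IH => f fs; apply: ls => y; rewrite inE => /predU1P[->|]; last exact: fs.
  by apply: contrapT => /eqP fx; apply: nf0; exists f.
pose c : R[i] := l f0 / f0 x.
pose l' (f : dual E) : R[i]^o := l f - c * f x.
have l'l : linear l'.
  move=> a f g; rewrite /l' linearP -[(a *: f + g) x]/(a * f x + g x).
  by rewrite -[a *: l f]/(a * l f) -[RHS]/(a * _ + _); ring.
pose l'L : {linear dual E -> R[i]^o} :=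
  HB.pack l' (GRing.isLinear.Build _ _ _ _ l' l'l).
have [|y l'y] := IH l'L.
  move=> f fs; rewrite /= /l'.
  have fE z : (f - (f x / f0 x) *: f0) z = f z - (f x / f0 x) * f0 z by [].
  (* This correction of [f] vanishes at [x] as well as on [s]. *)
  have : l (f - (f x / f0 x) *: f0) = 0.
    apply: ls => z; rewrite fE inE => /predU1P[->|zs].
      by rewrite mulfVK// subrr.
    by rewrite (fs z zs) (f0s z zs) mulr0 subrr.
  rewrite linearB linearZ /= => <-; congr (_ - _).
  by rewrite /c -[_ *: _]/(_ * l f0); ring.
exists (c *: x + y) => f.
have -> : f (c *: x + y) = c * f x + f y by rewrite linearP.
by rewrite -l'y /= /l' addrC subrK.
Qed.

Lemma wcbs_small_kernel (l : {linear dual E -> R[i]^o}) (e : R[i]) :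
    wcbs l -> 0 < e ->
  exists s : seq E, forall f : dual E, unit_ball (dual E) f ->
    (forall x, x \in s -> f x = 0) -> `|l f| <= e.
Proof.
move=> wl e0; apply: contrapT => /forallNP nex.
have bad (s : seq E) : exists f : dual E, [/\ unit_ball (dual E) f,
    forall x, x \in s -> f x = 0 & ~ `|l f| <= e].
  have /existsNP[f /not_implyP[f1 /not_implyP[fs fe]]] := nex s.
  by exists f.
(* The counterexample at [s] vanishes at every point of [s]; ordered by inclusion, the net is
   eventually zero at each point, so it tends weak-star to [0]. *)
pose psi s := projT1 (cid (bad s)).
pose le (s t : seq E) := {subset s <= t}.
have dle : directed le.
  split; first exact: (inhabits [::]).
  - by move=> s x.
  - by move=> s t u st tu x /st/tu.
  - by move=> s t; exists (s ++ t) => x xs; rewrite mem_cat xs ?orbT.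
have PT := tails_proper dle.
have psi1 : exists M, forall s, `|psi s| <= M.
  by exists 1 => s; rewrite /psi; case: cid => f [].
have psi0 : psi @ tails le --> (0 : weak_star E).
  apply/weak_star_cvgP => x; apply: cvg_near_cst.
  exists [:: x] => s xs; rewrite /psi /=; case: cid => f [_ fs _] /=.
  by rewrite fs//; apply: xs; rewrite inE.
have := wl _ le psi 0 dle psi1 psi0; rewrite linear0 => /cvgr0_norm_lt /(_ _ e0).
by move=> [s /(_ s (fun=> id))] /=; rewrite /psi; case: cid => f [_ _ fe] /= /ltW.
Qed.

Lemma wcbs_approximation (phi : dual (dual E)) (e : R) : wcbs phi -> 0 < e ->
  exists x : E, `|phi - canonical_embedding x| <= e%:C.
Proof.
move=> wphi e0; have eC0 : 0 < e%:C by rewrite ltcR.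
have [s ss] := wcbs_small_kernel wphi eC0.
(* The graph of [phi] on the joint kernel of [s]; its bound [e] on the unit ball spreads by
   homogeneity. *)
pose H := [set (f, phi f : R[i]) |
  f in [set f : dual E | forall x, x \in s -> f x = 0]].
have [|||psi [psie psiH]] := @hahn_banach R (dual E) e H (ltW e0).
- by exists 0 => //; rewrite linear0.
- move=> a _ _ [f fs <-] [g gs <-]; exists (a *: f + g) => /=.
    by move=> x xs; rewrite -[_ x]/(a * f x + g x) fs// gs// mulr0 addr0.
  by rewrite linearP.
- move=> _ [f fs <-] /=; have [->|f0] := eqVneq f 0.
    by rewrite linear0 !normr0 mulr0.
  have nf : 0 < `|f| by rewrite normr_gt0.
  rewrite -ler_pdivrMr// mulrC.
  have := ss (`|f|^-1 *: f); rewrite linearZ normrZ normfV normr_id; apply.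
    by rewrite /unit_ball/= normrZ normfV normr_id mulVf// gt_eqF.
  by move=> x xs; rewrite -[_ x]/(_ * f x) fs// mulr0.
have [f fs|x phix] := @evaluation_of_joint_kernel s (phi - psi).
  rewrite -[_ f]/(phi f - psi f); have := psiH (f, phi f); rewrite /= => ->.
    by rewrite subrr.
  by exists f.
exists x; rewrite (_ : phi - _ = psi); first last.
  apply/val_inj/funext => f; rewrite /= -[LHS]/(phi f - f x) -phix.
  by rewrite -[X in _ - X]/(phi f - psi f) opprB addrC subrK.
rewrite dual_normE lecR; apply: opnorm_le => f f1.
by rewrite (le_trans (psie f))// ler_piMr// ltW.
Qed.

Lemma canonical_embeddingB (x y : E) :
  canonical_embedding (x - y) = canonical_embedding x - canonical_embedding y.
Proof. by apply/val_inj/funext => f /=; rewrite linearB. Qed.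

(** A norming functional attains the norm of [x] on the dual unit ball; with the opposite
    inequality, the embedding is isometric. *)
Lemma canonical_embedding_ge_norm (x : E) : `|x| <= `|canonical_embedding x|.
Proof.
have [f [/dual_unit_ballP f1 fx]] := norming_functional x.
have := ler_dual_apply (canonical_embedding x) f; rewrite /= fx normr_id.
by move=> /le_trans; apply; rewrite ler_piMr.
Qed.

Lemma canonical_embedding_le_norm (x : E) : `|canonical_embedding x| <= `|x|.
Proof.
rewrite dual_normE -(Re_norm x) lecR; apply: opnorm_le => f f1.
by rewrite Re_norm (le_trans (ler_dual_apply f x))// ler_piMl.
Qed.

(** The approximants of [phi] form a filter base on [E], Cauchy because the embedding does not
    shrink norms; completeness gives a limit, whose evaluation is [phi]. *)
Theorem wcbs_evaluation (phi : dual (dual E)) : wcbs phi ->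
  exists x, canonical_embedding x = phi.
Proof.
move=> wphi.
pose F := filter_from [set e : R | 0 < e]
  (fun e => [set x : E | `|phi - canonical_embedding x| <= e%:C]).
have PF : ProperFilter F.
  apply: filter_from_proper; last by move=> e; exact: wcbs_approximation.
  apply: filter_from_filter; first by exists 1 => /=.
  move=> e d /= e0 d0; exists (Num.min e d); first by rewrite /= lt_min e0.
  by move=> x /= xed; split; rewrite /= (le_trans xed)// lecR ge_min lexx ?orbT.
have F_cauchy : cauchy F.
  apply/cauchyP => e e0.
  have eE : e = (complex.Re e)%:C by rewrite RRe_real// gtr0_real.
  (* Two errors of a third add up to strictly less than [e], as the open ball requires. *)
  have e'0 : 0 < complex.Re e / 3 by rewrite divr_gt0// -ltcR -eE.
  have [x xe] := wcbs_approximation wphi e'0.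
  exists x; exists (complex.Re e / 3) => // y ye; rewrite -ball_normE /=.
  rewrite (le_lt_trans (canonical_embedding_ge_norm _))// canonical_embeddingB.
  rewrite -(subrK phi (canonical_embedding x)) -addrA.
  rewrite (le_lt_trans (ler_normD _ _))// distrC (le_lt_trans (lerD xe ye))//.
  by rewrite -rmorphD eE ltcR; lra.
have /cvg_ex[x Fx] : cvg F by exact: cauchy_cvg.
exists x; apply/esym/eqP; rewrite -subr_eq0 -normr_le0.
apply/ler_addgt0Pr => e e0; rewrite add0r.
have eE : e = (complex.Re e)%:C by rewrite RRe_real// gtr0_real.
have e'0 : 0 < complex.Re e / 2 by rewrite divr_gt0// -ltcR -eE.
have F1 : F [set y | `|phi - canonical_embedding y| <= (complex.Re e / 2)%:C].
  by exists (complex.Re e / 2).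
have F2 : F (ball x (complex.Re e / 2)%:C) by apply/Fx/nbhsx_ballx; rewrite ltcR.
have [y [/= ye]] :
  [set y | `|phi - canonical_embedding y| <= (complex.Re e / 2)%:C] `&`
    ball x (complex.Re e / 2)%:C !=set0.
  by apply: (@filter_ex _ F); exact: filterI.
rewrite -ball_normE /= distrC => xy.
rewrite -(subrK (canonical_embedding y) phi) -addrA -canonical_embeddingB.
rewrite (le_trans (ler_normD _ _))// eE [complex.Re e in leRHS]splitr rmorphD.
by rewrite lerD// (le_trans (canonical_embedding_le_norm _))// ltW.
Qed.

End Grothendieck.

Theorem corollary2p9 (R : realType) (E : completeNormedModType R[i]) :
  [<-> reflexive_space E;
       forall A : completeNormedModType R[i],
         wcbs_operators E A = compact_operators E A;
       forall A : completeNormedModType R[i], finite_dimensional A ->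
         wcbs_operators E A = bounded_operators E A].
Proof.
tfae.
- move=> rE A; apply/seteqP; split=> L; first exact: wcbs_compact_map.
  exact: compact_map_wcbs.
- move=> WK A fdA; rewrite WK; apply/seteqP; split=> L.
    exact: compact_map_bounded.
  exact: bounded_map_compact.
- move=> WB; apply/seteqP; split=> // phi _.
  (* Applied to the complex line, the hypothesis makes every element of the bidual wcbs, hence an
     evaluation. *)
  have fd1 : finite_dimensional (complex_line R).
    exists 1%N, (fun=> 1 : R[i]^o) => a; exists (fun=> a).
    by rewrite big_ord1 -[_ *: _]/(a * 1) mulr1.
  have phiB : bounded_operators E (complex_line R) phi := dual_bounded phi.
  move: phiB; rewrite -WB// => /wcbs_evaluation[x <-].
  by exists x.
Qed.
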